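(* Let $n\ge 1$ and let $\mathbf{x}=(\mathbf{x}_1,\ldots,\mathbf{x}_n)$ be a proper transient vector. Let $\mathrm{xor}$, $\mathrm{or}$, $\mathrm{and}$ denote the $n$-variable boolean functions $x_1\oplus\cdots\oplus x_n$, $x_1+\cdots+x_n$ and $x_1\cdots x_n$. Then $$c_{\mathrm{xor}}(\mathbf{x})=0,$$ $$c_{\mathrm{or}}(\mathbf{x})=(u(\alpha(\mathbf{x}))\ominus 1)+(u(\omega(\mathbf{x}))\ominus 1),$$ $$c_{\mathrm{and}}(\mathbf{x})=(z(\alpha(\mathbf{x}))\ominus 1)+(z(\omega(\mathbf{x}))\ominus 1).$$
   Context: $B=\{0,1\}$. A transient is a nonempty word $\mathbf{t}=t_1\cdots t_m$ over $B$ in which consecutive letters differ; $\alpha(\mathbf{t})=t_1$, $\omega(\mathbf{t})=t_m$, $\Delta(\mathbf{t})=m-1$. The contraction of a nonempty binary word is obtained by deleting every letter equal to the letter immediately preceding it. A transient vector is $\mathbf{x}=(\mathbf{x}_1,\ldots,\mathbf{x}_n)$ with each $\mathbf{x}_i$ a transient; $\Delta(\mathbf{x})=\sum_i\Delta(\mathbf{x}_i)$, $\alpha(\mathbf{x})=(\alpha(\mathbf{x}_1),\ldots,\alpha(\mathbf{x}_n))\in B^n$, $\omega(\mathbf{x})=(\omega(\mathbf{x}_1),\ldots,\omega(\mathbf{x}_n))\in B^n$. $\mathbf{x}$ is proper if $\Delta(\mathbf{x}_i)\ge 1$ for all $i$. For a binary vector $b\in B^n$, $u(b)$ is the number of coordinates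 equal to $1$ and $z(b)$ the number equal to $0$. For integers, $m\ominus k=m-k$ if $m\ge k$ and $0$ otherwise. Transient extension: for $f:B^n\to B$ and a transient vector $\mathbf{x}$, a prefix of $\mathbf{x}$ is a vector $(\mathbf{p}_1,\ldots,\mathbf{p}_n)$ with each $\mathbf{p}_i$ a nonempty prefix of $\mathbf{x}_i$. The digraph $D_f(\mathbf{x})$ has the prefixes of $\mathbf{x}$ as vertices and an arc from $\mathbf{u}$ to $\mathbf{v}$ whenever $\mathbf{v}$ is obtained from $\mathbf{u}$ by appending one letter to exactly one component; each vertex $\mathbf{v}$ gets label $\lambda(\mathbf{v})=f(\omega(\mathbf{v}))$. For a directed path $P=\mathbf{v}^1,\ldots,\mathbf{v}^r$ from $\alpha(\mathbf{x})$ (the vector of first letters) to $\mathbf{x}$, let $\lambda(P)=\lambda(\mathbf{v}^1)\cdots\lambda(\mathbf{v}^r)$. The extension $\mathbf{f}(\mathbf{x})$ is the contraction of $\lambda(P)$ of maximal length over all such paths $P$. The cost of $\mathbf{x}$ for $f$ is $c_f(\mathbf{x})=\Delta(\mathbf{x})-\Delta(\mathbf{f}(\mathbf{x}))$. *)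

(* Defs.v *)
From mathcomp Require Import all_boot all_order all_algebra.
From mathcomp Require Import boolp classical_sets.
Set Implicit Arguments.
Unset Strict Implicit.
Unset Printing Implicit Defensive.

Definition word := seq bool.

Definition transient (t : word) : bool :=
  (t != [::]) && sorted (fun a b => a != b) t.

(* [alpha], [omega] and [Delta] are only meaningful on nonempty words. *)
Definition alpha (t : word) : bool := head false t.
Definition omega (t : word) : bool := last false t.
Definition Delta (t : word) : nat := (size t).-1.

(* [contract_from a w] contracts [w], knowing that the letter before it is [a]. *)
Fixpoint contract_from (a : bool) (w : word) : word :=
  if w is b :: w' then
    if b == a then contract_from b w' else b :: contract_from b w'
  else [::].

Definition contraction (w : word) : word :=
  if w is a :: w' then a :: contract_from a w' else [::].

Definition bvec (n : nat) := {ffun 'I_n -> bool}.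
Definition wordvec (n : nat) := {ffun 'I_n -> word}.

Section Vectors.
Variable n : nat.
Implicit Types (x u v : wordvec n) (b : bvec n).

Definition transient_vector x : Prop := forall i, transient (x i).
Definition proper_vector x : Prop := forall i, 1 <= Delta (x i).

Definition valpha x : bvec n := [ffun i => alpha (x i)].
Definition vomega x : bvec n := [ffun i => omega (x i)].
Definition vDelta x : nat := \sum_(i < n) Delta (x i).

Definition ones b : nat := #|[pred i | b i]|.
Definition zeros b : nat := #|[pred i | ~~ b i]|.

Definition is_prefix x u : bool :=
  [forall i, (u i != [::]) && prefix (u i) (x i)].

Definition append_at u (i : 'I_n) (a : bool) : wordvec n :=
  [ffun j => if j == i then rcons (u j) a else u j].

Definition arc x u v : bool :=
  [&& is_prefix x u, is_prefix x v & [exists i, exists a, v == append_at u i a]].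

(* [valpha x] seen as a vertex: a vector of one-letter words. *)
Definition source x : wordvec n := [ffun i => [:: alpha (x i)]].

(* [P] is the list of all vertices of the path, both ends included. *)
Definition full_path x (P : seq (wordvec n)) : bool :=
  if P is v :: P' then
    [&& v == source x, is_prefix x v, path (arc x) v P' & last v P' == x]
  else false.

Definition label (f : bvec n -> bool) (P : seq (wordvec n)) : word :=
  [seq f (vomega v) | v <- P].

Definition is_extension (f : bvec n -> bool) x (t : word) : Prop :=
  exists2 P, full_path x P &
    t = contraction (label f P) /\
    forall Q, full_path x Q -> size (contraction (label f Q)) <= size t.

(* The word characterised by [is_extension f x]; it exists and is unique
   for a transient vector [x] (lemmas [extensionP] and [is_extension_uniq]). *)
Definition extension (f : bvec n -> bool) x : word :=
  xget [::] [set t | is_extension f x t]%classic.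

(* Integer-valued, so that the difference is not truncated at 0. *)
Definition cost (f : bvec n -> bool) x : int :=
  ((vDelta x)%:Z - (Delta (extension f x))%:Z)%R.

Definition xorf b : bool := \big[addb/false]_(i < n) b i.
Definition orf b : bool := \big[orb/false]_(i < n) b i.
Definition andf b : bool := \big[andb/true]_(i < n) b i.

End Vectors.

Lemma is_prefixP n (x u : wordvec n) :
  reflect (forall i, u i != [::] /\ prefix (u i) (x i)) (is_prefix x u).
Proof.
by apply: (iffP fintype.forallP) => h i; [exact/andP/h | apply/andP/h].
Qed.

Lemma path_to_top n (x u : wordvec n) : is_prefix x u ->
  exists2 P, path (arc x) u P & last u P = x.
Proof.
move Ek: (\sum_(i < n) (size (x i) - size (u i))) => k.
elim: k u Ek => [|k IH] u Ek pu.
  exists [::] => //=; apply/ffunP => i.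
  have [_] := is_prefixP _ _ pu i; rewrite prefixE.
  move/eqP: Ek; rewrite sum_nat_eq0 => /fintype.forallP/(_ i) /=.
  by rewrite subn_eq0 => h /eqP <-; rewrite take_oversize.
have [i ui|none] := pickP (fun i => size (u i) < size (x i)); last first.
  by move: Ek; rewrite big1 // => i _; apply/eqP; rewrite subn_eq0 leqNgt none.
pose v := append_at u i (nth false (x i) (size (u i))).
have pv : is_prefix x v.
  apply/is_prefixP => j; rewrite ffunE; case: (j =P i) => [->|_].
    split; first by case: (u i).
    rewrite prefixE size_rcons (take_nth false) //.
    by have [_] := is_prefixP _ _ pu i; rewrite prefixE => /eqP ->.
  exact: (is_prefixP _ _ pu).
have Ev : \sum_(j < n) (size (x j) - size (v j)) = k.
  apply: succn_inj; rewrite -Ek (bigD1 i) //= [in RHS](bigD1 i) //= ffunE eqxx.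
  rewrite size_rcons subnS -addSn prednK ?subn_gt0 //; congr (_ + _).
  by apply: eq_bigr => j /negbTE ji; rewrite ffunE ji.
have [P hP lP] := IH v Ev pv; exists (v :: P) => //=; rewrite hP andbT.
rewrite /arc pu pv /=; apply/fintype.existsP; exists i.
by apply/fintype.existsP; exists (nth false (x i) (size (u i))).
Qed.

Lemma arc_size n (x u v : wordvec n) : arc x u v ->
  \sum_(i < n) size (v i) = (\sum_(i < n) size (u i)).+1.
Proof.
case/and3P=> _ _ /fintype.existsP[i /fintype.existsP[a /eqP ->]].
rewrite (bigD1 i) //= ffunE eqxx size_rcons [in RHS](bigD1 i) //= addSn.
by congr (_ + _).+1; apply: eq_bigr => j /negbTE ji; rewrite ffunE ji.
Qed.

Lemma full_path_size n (x : wordvec n) P : full_path x P ->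
  size P <= (\sum_(i < n) size (x i)).+1.
Proof.
case: P => //= v P /and4P[_ _ hP /eqP <-]; rewrite ltnS.
have -> : \sum_(i < n) size (last v P i) = \sum_(i < n) size (v i) + size P.
  elim: P v hP => [|w P IH] v /=; first by rewrite addn0.
  by case/andP=> /arc_size vw /IH ->; rewrite vw addSnnS.
exact: leq_addl.
Qed.

Lemma size_contraction w : size (contraction w) <= size w.
Proof.
case: w => //= a w; rewrite ltnS; elim: w a => //= b w IH a.
by case: eqP => _ /=; rewrite ?ltnS ?IH // ltnW ?ltnS ?IH.
Qed.

Lemma contraction_transient w : w != [::] -> transient (contraction w).
Proof.
case: w => // a w _; rewrite /transient /=; elim: w a => //= b w IH a.
by case: eqP => [->|/eqP ba] //=; rewrite eq_sym ba IH.
Qed.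

Lemma extensionP n (f : bvec n -> bool) (x : wordvec n) :
  transient_vector x -> is_extension f x (extension f x).
Proof.
move=> tx; apply: (@xgetPex _ [::] [set t | is_extension f x t]%classic).
pose Q k := `[< exists2 P, full_path x P & size (contraction (label f P)) = k >].
have exQ : exists k, Q k.
  have ps : is_prefix x (source x).
    apply/is_prefixP => i; rewrite ffunE; have /andP[] := tx i.
    by case: (x i) => //= a s _ _; rewrite eqxx prefix0s.
  have [P hP lP] := path_to_top ps.
  exists (size (contraction (label f (source x :: P)))).
  by apply/asboolP; exists (source x :: P) => //=; rewrite eqxx ps hP lP /=.
have ubQ k : Q k -> k <= (\sum_(i < n) size (x i)).+1.
  move/asboolP=> [P hP <-]; apply: leq_trans (full_path_size hP).
  by rewrite -(size_map (fun v => f (vomega v)) P) size_contraction.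
have [k /asboolP[P hP Pk] maxk] := ex_maxnP exQ ubQ.
exists (contraction (label f P)), P => //; split=> // R hR.
by rewrite Pk; apply: maxk; apply/asboolP; exists R.
Qed.

Lemma is_extension_uniq n (f : bvec n -> bool) (x : wordvec n) s t :
  is_extension f x s -> is_extension f x t -> s = t.
Proof.
case=> P hP [sP maxs] [R hR [tR maxt]].
have Est : size s = size t by apply/eqP; rewrite eqn_leq {1}sP maxt // tR maxs.
have [ns nt] : label f P != [::] /\ label f R != [::].
  by case: (P) (R) hP hR => [|? ?] [].
have Ehd : alpha s = alpha t.
  rewrite sP tR; case: (P) (R) hP hR => [|v P'] [|w R'] //=.
  by case/andP=> /eqP -> _ /andP[/eqP -> _].
move: (contraction_transient ns) (contraction_transient nt).
rewrite -sP -tR => {maxs maxt sP tR} /andP[s0 ss] /andP[t0 st].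
case: s t s0 t0 Est Ehd ss st => [|a s] [|b t] //= _ _ [] Est <-.
elim: s t Est a => [|c s IH] [|d t] //= [Est] a /andP[ac ss] /andP[ad st].
have cd : c = d by case: (a) (c) (d) ac ad => [] [] [].
by move: ss st; rewrite cd => ss st; have [->] := IH _ Est _ ss st.
Qed.

(* Main.v *)
Require Import Defs.
From mathcomp Require Import all_boot all_order all_algebra.
From mathcomp Require Import zify.
Set Implicit Arguments.
Unset Strict Implicit.
Unset Printing Implicit Defensive.
Import GRing.Theory.

(* Otherwise hidden by [path.arc]. *)
Local Notation arc := Defs.arc.

(** Every path from the first letters to [x] has [vDelta x] steps, each of which
    flips one coordinate of the vector of last letters, so the cost is the least
    number of steps that leave the label unchanged.  A step always changes [xor].
    For [or] a step is silent unless it enters or leaves the zero vector: a path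
    meeting that vector loses [u - 1] steps to reach it from [u] ones, and as
    many on the way out, while a path avoiding it is silent throughout,
    which is no better because [x] is proper.
    Conversely, bringing every coordinate to 0, then pulsing the coordinates one
    at a time, and finally raising those that end in 1 loses nothing more.  [and]
    is [or] with the letters exchanged, so both are treated as the test that some
    coordinate equals a given letter [c]. *)

(** * Alternating words and their prefixes *)

Lemma last_alternating a (s : word) :
  path (fun a b => a != b) a s -> last a s = a (+) odd (size s).
Proof.
elim: s a => [|b s IH] a /=; first by rewrite addbF.
by case/andP=> ab /IH ->; move: a b ab (odd _) => [] [] // _ [].
Qed.

(** Letters alternate, so only the parity of the number of remaining letters matters. *)
Lemma omega_prefix (t p : word) : transient t -> p != [::] -> prefix p t ->
  omega t = omega p (+) odd (size t - size p).
Proof.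
move=> /andP[_ st] p0 /prefixP[s Et]; move: st; rewrite {}Et /omega.
case: p p0 => //= a p _; rewrite cat_path => /andP[_ /last_alternating].
by rewrite last_cat size_cat subSS addKn.
Qed.

(** * Paths in the prefix digraph *)

Section Paths.
Variables (n : nat) (x : wordvec n).
Hypothesis x_transient : transient_vector x.
Implicit Types (u v : wordvec n) (b : bvec n) (P : seq (wordvec n)).

Definition flips (i : 'I_n) b b' := forall j, b' j = (j == i) (+) b j.

Lemma arc_append_flips u i a :
  arc x u (append_at u i a) -> flips i (vomega u) (vomega (append_at u i a)).
Proof.
case/and3P=> /is_prefixP pu /is_prefixP pv _ j.
move: (pv j); rewrite !ffunE; case: (j =P i) => // _ [ne pr].
have [ne' pr'] := pu j.
have lt : (size (u j) < size (x j))%N by rewrite -(size_rcons _ a) size_prefix.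
have := omega_prefix (x_transient j) ne pr.
rewrite (omega_prefix (x_transient j) ne' pr') size_rcons.
rewrite -[(size (x j) - size (u j))%N]prednK ?subn_gt0 // -subnS /=.
by case: (omega (u j)) (omega (rcons _ _)) (odd _) => [] [] [].
Qed.

Lemma arc_flips u v : arc x u v -> exists i, flips i (vomega u) (vomega v).
Proof.
move=> uv; case/and3P: (uv) => _ _ /fintype.existsP[i /fintype.existsP[a /eqP Ev]].
by exists i; rewrite Ev; apply: arc_append_flips; rewrite -Ev.
Qed.

Lemma arc_exists u i : is_prefix x u -> (size (u i) < size (x i))%N ->
  exists v, [/\ arc x u v, flips i (vomega u) (vomega v)
              & forall j, size (v j) = (size (u j) + (j == i))%N].
Proof.
move=> pu lt; set v := append_at u i (nth false (x i) (size (u i))).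
have uv : arc x u v.
  apply/and3P; split=> //; last first.
    apply/fintype.existsP; exists i; apply/fintype.existsP.
    by exists (nth false (x i) (size (u i))).
  apply/is_prefixP => j; have [ne pr] := is_prefixP _ _ pu j.
  rewrite ffunE; case: (j =P i) => [Ej|_]; last by [].
  rewrite Ej in ne pr *; split; first by case: (u i).
  by move: pr; rewrite !prefixE size_rcons (take_nth false) // => /eqP ->.
exists v; split=> //; first exact: arc_append_flips.
move=> j; rewrite ffunE; case: eqP => _; last by rewrite addn0.
by rewrite size_rcons addn1.
Qed.

Lemma path_size u P : path (arc x) u P ->
  (\sum_(i < n) size (last u P i) = \sum_(i < n) size (u i) + size P)%N.
Proof.
elim: P u => [|v P IH] u /=; first by rewrite addn0.
by case/andP=> /arc_size uv /IH ->; rewrite uv addSnnS.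
Qed.

Lemma source_prefix : is_prefix x (source x).
Proof.
apply/is_prefixP => i; rewrite ffunE; have /andP[] := x_transient i.
by case: (x i) => //= a s _ _; rewrite eqxx prefix0s.
Qed.

Lemma vomega_source : vomega (source x) = valpha x.
Proof. by apply/ffunP => i; rewrite !ffunE. Qed.

Lemma full_path_source P : path (arc x) (source x) P -> last (source x) P = x ->
  full_path x (source x :: P).
Proof. by move=> hP lP; rewrite /= eqxx source_prefix hP lP /=. Qed.

Lemma full_pathP Q : full_path x Q ->
  exists P, [/\ Q = source x :: P, path (arc x) (source x) P,
               last (source x) P = x & size P = vDelta x].
Proof.
case: Q => // v P /and4P[/eqP -> _ hP /eqP lP]; exists P; split=> //.
have := path_size hP; rewrite lP => E; apply: (@addnI (\sum_(i < n) size (source x i))).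
rewrite -{}E /vDelta -big_split; apply: eq_bigr => i _ /=; rewrite ffunE /Delta.
by have /andP[] := x_transient i; case: (x i).
Qed.

(** * Label changes along a path *)

Section Changes.
Variable f : bvec n -> bool.

(** This is [Delta] of the contracted label of [u :: P], in a form that recurses along [P]. *)
Definition changes u P : nat :=
  size (contract_from (f (vomega u)) (label f P)).

Lemma changes_cons u v P :
  changes u (v :: P) = ((f (vomega v) != f (vomega u)) + changes v P)%N.
Proof. by rewrite /changes /=; case: eqP. Qed.

Lemma changes0 u P : changes u P = 0%N -> f (vomega (last u P)) = f (vomega u).
Proof.
by elim: P u => //= v P IH u; rewrite changes_cons; case: eqP => // <- /IH.
Qed.

(** All full paths have [vDelta x] steps, so it suffices that each has at least [k] silent steps and
    some path at most [k]. *)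
Lemma cost_eq k :
    (forall P, path (arc x) (source x) P -> last (source x) P = x ->
       size P = vDelta x -> (changes (source x) P + k <= vDelta x)%N) ->
    (exists P, [/\ path (arc x) (source x) P, last (source x) P = x
                 & (size P <= changes (source x) P + k)%N]) ->
  cost f x = k%:Z%R.
Proof.
move=> ub [P [hP lP lb]].
have [Q fQ [EQ maxQ]] := extensionP f x_transient.
have [R [ER hR lR sR]] := full_pathP fQ.
have fP := full_path_source hP lP.
have [P' [[EP'] _ _ sP]] := full_pathP fP; subst P'.
have := maxQ _ fP; have := ub _ hR lR sR.
rewrite /cost /Delta {}EQ ER /= -/(changes _ R) -/(changes _ P) => h1 h2.
by lia.
Qed.

End Changes.

(** * Exclusive or *)

Lemma xorf_flips i b b' : flips i b b' -> xorf b' = ~~ xorf b.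
Proof.
move=> fb; rewrite /xorf (bigD1 i) //= [in RHS](bigD1 i) //= fb eqxx /= addNb.
by congr (~~ (_ (+) _)); apply: eq_bigr => j /negbTE ji; rewrite fb ji.
Qed.

Lemma changes_xorf u P : path (arc x) u P -> changes (@xorf n) u P = size P.
Proof.
elim: P u => //= v P IH u /andP[/arc_flips[i /xorf_flips uv] /IH].
by rewrite changes_cons uv => ->; case: (xorf _).
Qed.

Lemma cost_xorf : cost (@xorf n) x = 0%R.
Proof.
apply: (@cost_eq _ 0) => [P hP _ <-|]; first by rewrite addn0 changes_xorf.
have [P hP lP] := path_to_top source_prefix.
by exists P; split=> //; rewrite addn0 changes_xorf.
Qed.

(** * Functions that test for a letter [c], with [e] negating the test *)

Section Detect.
Variables (c e : bool) (f : bvec n -> bool).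

Definition occ b : nat := \sum_(i < n) (b i == c).

Hypothesis f_detects : forall b, f b = e (+) (0 < occ b)%N.

Lemma occ_flips i b b' : flips i b b' ->
  (occ b' + (b i == c) = occ b + (b i != c))%N.
Proof.
move=> fb; rewrite /occ (bigD1 i) //= [in RHS](bigD1 i) //= fb eqxx.
rewrite (eq_bigr (fun j => b j == c : nat)) => [|j /negbTE ji]; last by rewrite fb ji.
by case: (b i) (c) => [] []; rewrite /= ?addn0 ?add0n addnC.
Qed.

Lemma detect_neq b b' : (f b' != f b) = ((0 < occ b') != (0 < occ b))%N.
Proof. by rewrite !f_detects; case: e (0 < _)%N (0 < _)%N => [] [] []. Qed.

Lemma occ_path u P : path (arc x) u P ->
  (occ (vomega (last u P)) <= occ (vomega u) + size P)%N.
Proof.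
elim: P u => [|v P IH] u /=; first by rewrite addn0.
by case/andP=> /arc_flips[i /occ_flips] + /IH; case: eqP => /=; lia.
Qed.

(** The first alternative is for constant labels, where the bound can fail. If the first step is the
    only change, its ends have [occ] 0 and 1, and [occ_path] bounds [occ] at the far end. *)
Lemma changes_detect_ub u P : path (arc x) u P ->
  changes f u P = 0%N \/
  (changes f u P + ((occ (vomega u) - 1) + (occ (vomega (last u P)) - 1))
     <= size P)%N.
Proof.
elim: P u => [|v P IH] u /=; first by left.
case/andP=> /arc_flips[i /occ_flips uv] hP; have := occ_path hP.
rewrite changes_cons detect_neq; have := IH v hP.
by move: uv; case: eqP => _ /=; lia.
Qed.

(** This parity gains the missing unit whenever a bound on the remaining letters is one short. *)
Lemma parity_remaining u i : is_prefix x u ->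
  ((omega (u i) == c) + (omega (x i) == c) + (size (x i) - size (u i)))%N
    = 0 %[mod 2].
Proof.
move=> /is_prefixP/(_ i)[ne pr]; apply/eqP.
rewrite (omega_prefix (x_transient i) ne pr) !modn2 !oddD !oddb.
by case: (omega _) (c) (odd _) => [] [] [].
Qed.

(* Greedy choice: flip any coordinate equal to [c]; if there is none, flip one
   with at least two letters left.  By parity both moves preserve the hypothesis
   on the remaining letters. *)
Lemma changes_detect_lb u : is_prefix x u ->
    (forall i, (omega (u i) == c) + (omega (x i) == c)
                 <= size (x i) - size (u i))%N ->
  exists P, [/\ path (arc x) u P, last u P = x &
    (size P <= changes f u P + ((occ (vomega u) - 1) + (occ (vomega x) - 1)))%N].
Proof.
have [k] := ubnP (\sum_(i < n) size (x i) - \sum_(i < n) size (u i))%N.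
elim: k u => // k IH u Ek pu room.
(* A coordinate flipped to [c] must keep a letter with which to leave [c] again, hence the 2. *)
have step i : (omega (u i) == c) + (omega (u i) != c) * 2 <= size (x i) - size (u i) ->
    (omega (u i) == c) || (occ (vomega u) == 0) ->
  exists P, [/\ path (arc x) u P, last u P = x &
    (size P <= changes f u P + ((occ (vomega u) - 1) + (occ (vomega x) - 1)))%N].
  move=> ri good.
  have lt : (size (u i) < size (x i))%N by case: eqP ri => _ /=; lia.
  have [v [uv fl sz]] := arc_exists pu lt.
  have pv : is_prefix x v by case/and3P: uv.
  have Ev := arc_size uv.
  have lev : (\sum_(i < n) size (v i) <= \sum_(i < n) size (x i))%N.
    by apply: leq_sum => j _; apply: size_prefix; case: (is_prefixP _ _ pv j).
  have rv j : ((omega (v j) == c) + (omega (x j) == c) <= size (x j) - size (v j))%N.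
    have := room j; have := parity_remaining j pu; rewrite sz.
    have := fl j; rewrite !ffunE => ->; case: (j =P i) => [->|_] /=.
      by move: ri; case: (omega (u i)) (omega (x i)) (c) => [] [] [] /=; lia.
    by rewrite addn0.
  have [|P [hP lP sP]] := IH v _ pv rv; first by lia.
  exists (v :: P); split; rewrite /= ?uv //.
  rewrite changes_cons detect_neq.
  have := occ_flips fl; rewrite ffunE; move: good; case: eqP => _ /=; lia.
have [i ui|none] := pickP (fun i => omega (u i) == c).
  apply: (step i); last by rewrite ui.
  by have := room i; rewrite ui; lia.
have u0 : occ (vomega u) = 0%N.
  by rewrite /occ big1 // => i _; rewrite ffunE none.
have [i ri|small] := pickP (fun i => 1 < size (x i) - size (u i))%N.
  by apply: (step i); rewrite ?none ?u0.
(* Each coordinate has at most one letter left, so any path only flips those ending in [c]. *)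
have [P hP lP] := path_to_top pu; exists P; split=> //.
have sP : (size P <= occ (vomega x))%N.
  rewrite -(leq_add2l (\sum_(i < n) size (u i))) -path_size // lP -big_split /=.
  apply: leq_sum => i _; rewrite ffunE.
  have := parity_remaining i pu; have := small i; rewrite none.
  by case: eqP => _ /=; lia.
(* If [occ (vomega x)] is positive, the labels at the two ends differ, so at least one step is not
   silent. *)
have := @changes0 f u P; rewrite lP !f_detects u0.
case: (changes f u P) => [/(_ erefl)|m _]; last by lia.
by case: e; case: (occ _) sP => //; lia.
Qed.

Lemma cost_detect : proper_vector x ->
  cost f x = ((occ (valpha x) - 1) + (occ (vomega x) - 1))%N%:Z%R.
Proof.
move=> x_proper.
(* If both end letters are [c], the number of letters left is even and, by properness, positive,
   hence at least 2. *)
have room i : ((omega (source x i) == c) + (omega (x i) == c)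
                 <= size (x i) - size (source x i))%N.
  have := parity_remaining i source_prefix; have := x_proper i.
  rewrite ffunE /Delta /=.
  by case: eqP => _; case: eqP => _ /=; lia.
apply: cost_eq; last first.
  by rewrite -vomega_source; apply: changes_detect_lb; first exact: source_prefix.
move=> P hP lP sP; rewrite -vomega_source.
(* With a constant label all [vDelta x] steps are silent, and summing [room] shows that these are
   enough. *)
have [-> | ] := changes_detect_ub hP; last by rewrite lP sP.
suff : (occ (vomega (source x)) + occ (vomega x) <= vDelta x)%N by lia.
rewrite /occ -big_split; apply: leq_sum => i _; have := room i.
by rewrite !ffunE /Delta /= subn1.
Qed.

End Detect.
End Paths.

(** * Or and and as tests for a letter *)

Lemma occ_card n c (b : bvec n) : occ c b = #|[pred i | b i == c]|.
Proof.
rewrite /occ -sum1_card [in RHS]big_mkcond.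
by apply: eq_bigr => i _; rewrite inE; case: eqP.
Qed.

Lemma occ_ones n (b : bvec n) : occ true b = ones b.
Proof. by rewrite occ_card; apply: eq_card => i; rewrite !inE eqb_id. Qed.

Lemma occ_zeros n (b : bvec n) : occ false b = zeros b.
Proof. by rewrite occ_card; apply: eq_card => i; rewrite !inE eqbF_neg. Qed.

Lemma orf_detects n (b : bvec n) : orf b = false (+) (0 < occ true b)%N.
Proof.
rewrite /orf big_orE occ_ones /=.
by apply/fintype.existsP/card_gt0P.
Qed.

Lemma andf_detects n (b : bvec n) : andf b = true (+) (0 < occ false b)%N.
Proof.
rewrite /andf big_andE occ_zeros addTb -[LHS]negbK negb_forall; congr (~~ _).
by apply/fintype.existsP/card_gt0P.
Qed.

Local Open Scope ring_scope.

Theorem theorem1 (n : nat) (x : wordvec n) (n_ge1 : (1 <= n)%N)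
    (x_transient : transient_vector x) (x_proper : proper_vector x) :
  [/\ cost (@xorf n) x = 0,
      cost (@orf n) x =
        ((ones (valpha x) - 1) + (ones (vomega x) - 1))%N%:Z
    & cost (@andf n) x =
        ((zeros (valpha x) - 1) + (zeros (vomega x) - 1))%N%:Z].
Proof.
split; first exact: cost_xorf.
- by rewrite (cost_detect x_transient (@orf_detects n) x_proper) !occ_ones.
- by rewrite (cost_detect x_transient (@andf_detects n) x_proper) !occ_zeros.
Qed.
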